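(* Let $p$ range over primes $p>3$. (i) For $n\in\{4,-3,9,-8,\tfrac14,\tfrac34,\tfrac43,-\tfrac13\}$, the functions $p\mapsto F_p(0,1,n)\bmod 16$ are pairwise equivalent. (ii) The function $p\mapsto F_p(0,1,4)\bmod 16$ is equivalent to $p\mapsto\prod_{0<i<j<p/2,\ p\nmid f(i,j)}\big(\frac{f(i,j)}{p}\big)$ for each of the forms $f(i,j)=i^2+ij+j^2,\ i^2-ij+j^2,\ 2i^2+5ij+2j^2,\ 2i^2-5ij+2j^2,\ 4i^2-j^2,\ 9i^2-j^2,\ 3i^2+j^2,\ 8i^2+j^2$. (iii) $p\mapsto F_p(0,1,4)\bmod 16$ and all the products in (ii) are periodic functions of $p$.
   Context: $\big(\frac{\cdot}{p}\big)$ is the Legendre symbol; products are over integers $i,j$. For a rational $n$ whose denominator is prime to $p$, $F_p(0,1,n)=\sum_{y=1}^{p}\big(\frac{y(y+1)(y+w)}{p}\big)$ where $w$ is an integer with $w\equiv n\pmod p$; ''$\bmod 16$'' denotes the least nonnegative residue modulo $16$. A function $g$ on a set of primes is periodic if there is $m\in\mathbb Z_{>0}$ with $g(p_1)=g(p_2)$ whenever $p_1\equiv p_2\pmod m$ lie in its domain. Two functions $g,h$ on sets of primes are equivalent if there is $m\in\mathbb Z_{>0}$ such that for each $r$ with $1\le r<m$, $\gcd(r,m)=1$, there is a degree-one polynomial $f_r$ with rational coefficients such that $g(p)=f_r(h(p))$ for all primes $p$ in the common domain with $p\equiv r\pmod m$. *)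

(* Defs.v *)
From mathcomp Require Import all_boot all_order all_algebra.

Set Implicit Arguments.
Unset Strict Implicit.
Unset Printing Implicit Defensive.

Import Order.TTheory GRing.Theory Num.Theory.
Local Open Scope ring_scope.

Definition legendre (p : nat) (a : int) : int :=
  if (p %| a)%Z then 0
  else if [exists x : 'I_p, (x%:Z ^+ 2 == a %[mod p])%Z] then 1 else -1.

(* The integer w with 0 <= w < p and w = n modulo p; meaningful only when p is
   a prime that does not divide the denominator of n. *)
Definition ratmod (p : nat) (n : rat) : int :=
  if [pick w : 'I_p | (w%:Z * denq n == numq n %[mod p])%Z] is Some w
  then w%:Z else 0.

(* F_p(0, 1, n) *)
Definition F01 (p : nat) (n : rat) : int :=
  \sum_(1 <= y < p.+1) legendre p (y%:Z * (y%:Z + 1) * (y%:Z + ratmod p n)).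

Definition F01mod16 (n : rat) (p : nat) : int := (F01 p n %% 16)%Z.

(* The triple (a, b, c) stands for the form a i^2 + b i j + c j^2. *)
Definition qform (f : int * int * int) (i j : int) : int :=
  f.1.1 * i ^+ 2 + f.1.2 * (i * j) + f.2 * j ^+ 2.

(* For naturals, j < p/2 is rendered without division as 2j < p. *)
Definition form_product (f : int * int * int) (p : nat) : int :=
  \prod_(i < p) \prod_(j < p |
      [&& (0 < i)%N, (i < j)%N, (j.*2 < p)%N & ~~ (p %| qform f i%:Z j%:Z)%Z])
    legendre p (qform f i%:Z j%:Z).

Definition primes_gt3 : pred nat := fun p => prime p && (3 < p)%N.

Definition periodic_on (D : pred nat) (g : nat -> int) : Prop :=
  exists m : nat, (0 < m)%N /\
    forall p1 p2 : nat, D p1 -> D p2 -> p1 = p2 %[mod m] -> g p1 = g p2.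

(* D is the common domain of g and h.  The modulus m = 1 is excluded: the range
   1 <= r < m would then be empty and any two functions would be equivalent. *)
Definition equivalent_on (D : pred nat) (g h : nat -> int) : Prop :=
  exists m : nat, (1 < m)%N /\
    forall r : nat, (1 <= r < m)%N -> coprime r m ->
      exists2 f : {poly rat}, size f = 2%N &
        forall p : nat, D p -> p = r %[mod m] -> (g p)%:~R = f.[(h p)%:~R].

Definition params : seq rat :=
  [:: 4; -3; 9; -8; 1 / 4; 3 / 4; 4 / 3; - (1 / 3)].

Definition forms : seq (int * int * int) :=
  [:: (1, 1, 1); (1, -1, 1); (2, 5, 2); (2, -5, 2);
      (4, 0, -1); (9, 0, -1); (3, 0, 1); (8, 0, 1)].

Lemma legendre_mod (p : nat) (a b : int) :
  (a = b %[mod p])%Z -> legendre p a = legendre p b.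
Proof.
move=> ab; rewrite /legendre.
have -> : (p %| a)%Z = (p %| b)%Z.
  by apply/idP/idP => /dvdz_mod0P h; apply/dvdz_mod0P; rewrite ?ab // -ab.
by case: ifP => // _; congr (if _ then _ else _); apply: eq_existsb => x; rewrite ab.
Qed.

(* F01 may be computed with any integer w congruent to n modulo p. *)
Lemma F01E (p : nat) (n : rat) (w : int) :
  prime p -> ~~ (p %| denq n)%Z -> (w * denq n = numq n %[mod p])%Z ->
  F01 p n = \sum_(1 <= y < p.+1) legendre p (y%:Z * (y%:Z + 1) * (y%:Z + w)).
Proof.
move=> p_pr pd wn.
have p0 : (p%:Z != 0) by case: p p_pr {pd wn}.
have cop : coprimez p (denq n) by rewrite /coprimez /gcdz; move: pd;
  rewrite dvdzE -prime_coprime // /coprime => /eqP ->.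
have rw : (ratmod p n = w %[mod p])%Z.
  rewrite /ratmod; case: pickP => [v /eqP vn|nov].
    apply/eqP; rewrite eqz_mod_dvd -(Gauss_dvdzl _ cop) mulrBl -eqz_mod_dvd.
    by rewrite vn wn.
  have lt : (`|(w %% p)%Z| < p)%N.
    by rewrite -ltz_nat gez0_abs ?modz_ge0 // ltz_pmod // ltz_nat prime_gt0.
  have := nov (Ordinal lt); rewrite /= gez0_abs ?modz_ge0 //.
  by rewrite modzMml wn eqxx.
apply: eq_bigr => y _; apply: legendre_mod.
by rewrite -modzMmr -modzDmr rw modzDmr modzMmr.
Qed.

(* Main.v *)
Require Import Defs.
From mathcomp Require Import all_boot all_order all_algebra.
From mathcomp Require Import finfield cyclic ring zify.
From Stdlib Require Classical_Prop.
Import Order.TTheory GRing.Theory Num.Theory.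
Local Open Scope ring_scope.
Set Implicit Arguments.
Unset Strict Implicit.
Unset Printing Implicit Defensive.

(** Periodic functions are equivalent (take [f_r = X + c]), so everything reduces
    to (iii) for all the functions involved; 48 is a common period.

    Write [F(n)] for [F_p(0,1,n)] and [chi] for the Legendre symbol. Affine
    substitutions give [F(1-n) = chi(-1) F(n)] and [F(1/n) = chi(n) F(n)], and a
    2-isogeny gives [F(9) = chi(-1) F(4)]; so every [F(n)] is [F(4)] up to a
    character value. Expanding [(1 - chi(a + g u^2)) (1 - chi(1 - u^2))] and
    summing over [u] expresses [4 K], for [K] the number of [u] at which both
    symbols are [-1], by [F(-a/g)] and character values. Thus [K mod 4] and
    [F(-a/g) mod 16] determine each other.

    For [a = 3], [g = 1] the order 3 map [u -> (u + 3) / (1 - u)] and the sign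
    change generate a group preserving the first symbol, and the product of the
    second symbol over an orbit of the order 3 map is 1. Hence [K mod 4] comes
    from [u = 3, -3] alone, which gives [F(4) mod 16].

    For a form [a i^2 + g j^2], put [j = |u i|]. By Gauss's lemma the number of [i]
    with [i < |u i|] has the parity given by [chi(1 - u^2)], so the product is
    [(-1)^(K/2)]. A form [a i^2 + b i j + a j^2] is reduced to a diagonal one by
    the permutation [(i, j) -> (j - i, |i + j|)] of the pairs [0 < i < j < p/2]. *)

(** The orbits [{x, s x}] have two elements each; the induction removes one of them. *)
Lemma card_free_involution (T : finType) (s : T -> T) (C : {set T}) :
  involutive s -> {in C, forall x, s x \in C} -> {in C, forall x, s x != x} ->
  ~~ odd #|C|.
Proof.
move=> sK; have [n] := ubnP #|C|; elim: n C => // n IHn C le_n sC free.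
have [->|[x xC]] := set_0Vmem C; first by rewrite cards0.
have nx := free x xC.
have sxC : s x \in C :\ x by rewrite !inE nx sC.
rewrite (cardsD1 x) xC (cardsD1 (s x)) sxC /= negbK.
apply: IHn; first by rewrite (cardsD1 x) xC (cardsD1 (s x)) sxC /= in le_n; lia.
  move=> y; rewrite !inE => /and3P[ysx yx yC]; rewrite sC // andbT.
  by rewrite (inj_eq (inv_inj sK)) yx (can2_eq sK sK) ysx.
by move=> y; rewrite !inE => /and3P[_ _ /free].
Qed.

(** * The quadratic character of a finite field *)

(** The Legendre symbol on a field, with values in [int] so that its sums are integers. *)
Definition quadchar (F : finFieldType) (x : F) : int :=
  if x == 0 then 0 else if [exists y : F, y ^+ 2 == x] then 1 else -1.

Section QuadraticCharacter.

Variable F : finFieldType.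
Hypothesis two_neq0 : 2%:R != 0 :> F.
Implicit Types x y z u v w : F.

Local Notation chi := (@quadchar F).

Lemma oppr_neq x : x != 0 -> - x != x.
Proof.
by move=> x0; rewrite eq_sym -subr_eq0 opprK -mulr2n -(mulr_natl x) mulf_neq0.
Qed.

Lemma quadchar0 : chi 0 = 0. Proof. by rewrite /quadchar eqxx. Qed.

Lemma quadchar_eq0 x : (chi x == 0) = (x == 0).
Proof. by rewrite /quadchar; case: (x == 0) => //; case: ifP. Qed.

Lemma quadcharP x : x != 0 -> chi x = 1 \/ chi x = -1.
Proof. by rewrite /quadchar => /negPf ->; case: ifP; [left|right]. Qed.

Lemma card_field_half : #|F|.-1 = (#|F|.-1./2).*2.
Proof.
rewrite -[in LHS](odd_double_half #|F|.-1).
suff -> : odd #|F|.-1 = false by [].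
have -> : #|F|.-1 = #|[set~ (0 : F)]| by rewrite cardsC1.
apply/negbTE/(@card_free_involution _ -%R); first exact: opprK.
  by move=> x; rewrite !inE oppr_eq0.
by move=> x; rewrite !inE => /oppr_neq.
Qed.

Lemma expf_card1 x : x != 0 -> x ^+ #|F|.-1 = 1.
Proof.
move=> x0; apply: (mulfI x0); rewrite -exprS mulr1 prednK ?expf_card //.
by rewrite (cardD1 0).
Qed.

Lemma field_prim_root : exists z : F, #|F|.-1.-primitive_root z.
Proof.
have : has #|F|.-1.-primitive_root (enum [set~ (0 : F)]).
  apply: has_prim_root; rewrite ?enum_uniq -?cardE ?cardsC1 //.
    by rewrite -subn1 subn_gt0 finNzRing_gt1.
  apply/allP => x; rewrite mem_enum !inE => x0.
  by apply/unity_rootP/expf_card1.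
by case/hasP => z _ hz; exists z.
Qed.

(** For [m] half of [#|F|.-1], a nonzero [x] has [x ^+ m] equal to 1 or -1. The value 1 makes the
    exponent of [x] to a primitive root even, hence [x] a square. *)
Lemma euler_criterion x : x ^+ #|F|.-1./2 = (chi x)%:~R.
Proof.
have [z zP] := field_prim_root.
have m_gt0 : (0 < #|F|.-1./2)%N.
  by rewrite -double_gt0 -card_field_half -subn1 subn_gt0 finNzRing_gt1.
have [->|x0] := eqVneq x 0; first by rewrite quadchar0 expr0n gtn_eqF.
rewrite /quadchar (negPf x0); case: existsP => [[y /eqP xE]|nsq].
  rewrite -{x}xE in x0 *.
  rewrite -exprM mul2n -card_field_half expf_card1 //.
  by apply: contraNneq x0 => ->; rewrite expr0n.
have xm2 : (x ^+ #|F|.-1./2) ^+ 2 = 1 ^+ 2.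
  by rewrite expr1n -exprM muln2 -card_field_half expf_card1.
move/eqP: xm2; rewrite eqf_sqr => /orP[|/eqP-> //] /eqP xm1; case: nsq.
have [i xi] := prim_rootP zP (expf_card1 x0).
exists (z ^+ i./2); rewrite -exprM muln2 xi.
suff : ~~ odd i by move/even_halfK => ->.
move/eqP: xm1; rewrite xi -exprM -(prim_order_dvd zP).
rewrite {1}card_field_half -mul2n dvdn_pmul2r //.
by rewrite dvdn2.
Qed.

End QuadraticCharacter.

Section QuadraticCharacter.

Variable F : finFieldType.
Hypothesis two_neq0 : 2%:R != 0 :> F.
Implicit Types x y z u v w : F.

Local Notation chi := (@quadchar F).

Lemma quadchar1 : chi 1 = 1.
Proof.
rewrite /quadchar oner_eq0; case: existsP => // -[]; exists 1.
by rewrite expr1n.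
Qed.

(** Euler's criterion gives the identity in [F]; it lifts to [int] because -1 and 1 differ in
    [F]. *)
Lemma quadcharM x y : chi (x * y) = chi x * chi y.
Proof.
have [->|x0] := eqVneq x 0; first by rewrite mul0r quadchar0 mul0r.
have [->|y0] := eqVneq y 0; first by rewrite mulr0 quadchar0 mulr0.
have : (chi (x * y))%:~R = (chi x * chi y)%:~R :> F.
  by rewrite intrM -!(euler_criterion two_neq0) exprMn.
have n1 : -1 != 1 :> F by apply: oppr_neq; rewrite ?oner_eq0.
have n2 : (1 != -1 :> F) by rewrite eq_sym.
by case: (quadcharP (mulf_neq0 x0 y0)) => ->; case: (quadcharP x0) => ->;
  case: (quadcharP y0) => -> // /eqP; rewrite /= ?(negPf n1) ?(negPf n2).
Qed.

Lemma quadchar_sqr x : x != 0 -> chi (x ^+ 2) = 1.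
Proof. by move=> x0; rewrite expr2 quadcharM; case: (quadcharP x0) => ->. Qed.

Lemma quadchar_sqrM x y : x != 0 -> chi (x ^+ 2 * y) = chi y.
Proof. by move=> x0; rewrite quadcharM quadchar_sqr ?mul1r. Qed.

Lemma quadcharV x : chi x^-1 = chi x.
Proof.
have [->|x0] := eqVneq x 0; first by rewrite invr0.
by rewrite -(quadchar_sqrM x^-1 x0) expr2 mulfK.
Qed.

(** Were every element a square, squaring would be injective by finiteness, but 1 and -1 have the
    same square. *)
Lemma quadchar_nonres : exists a : F, chi a = -1.
Proof.
have [/forallP h|] := boolP [forall x : F, exists y, y ^+ 2 == x]; last first.
  rewrite negb_forall => /existsP[a an]; exists a.
  rewrite /quadchar (negPf an); case: eqP => // a0; case/existsP: an.
  by exists 0; rewrite a0 expr0n.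
have : (-1 : F) = 1.
  have /imset_injP inj2 : #|[set x ^+ 2 | x in [set: F]]| == #|[set: F]|.
    apply/eqP; congr #|pred_of_set _|; apply/setP => x; rewrite inE.
    by have /existsP[y /eqP <-] := h x; apply: imset_f; rewrite inE.
  by apply: inj2; rewrite ?inE // sqrrN.
by move/eqP; rewrite (negPf (oppr_neq two_neq0 (oner_neq0 F))).
Qed.

(** * Character sums of degree one and two *)

Lemma sum_quadchar : \sum_(x : F) chi x = 0.
Proof.
(* Multiplying the variable by a nonresidue negates the sum. *)
have [a an] := quadchar_nonres.
have a0 : a != 0 by rewrite -quadchar_eq0 an.
have : \sum_(x : F) chi x = - \sum_(x : F) chi x.
  rewrite {1}(reindex_inj (mulfI a0)) -sumrN.
  by apply: eq_bigr => x _; rewrite quadcharM an mulN1r.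
lia.
Qed.

Lemma card_sqrt v : #|[set x | x ^+ 2 == v]|%:Z = 1 + chi v.
Proof.
have [->|v0] := eqVneq v 0.
  rewrite quadchar0 (_ : [set x | _] = [set 0]) ?cards1 //.
  by apply/setP => x; rewrite !inE sqrf_eq0.
rewrite /quadchar (negPf v0); case: existsP => [[y /eqP yv]|nsq].
  have y0 : y != 0 by apply: contraNneq v0 => y0; rewrite -yv y0 expr0n.
  rewrite (_ : [set x | _] = [set - y; y]) ?cards2 ?oppr_neq //.
  by apply/setP => x; rewrite !inE -yv eqf_sqr orbC.
rewrite (_ : [set x | _] = set0) ?cards0 //.
by apply/setP => x; rewrite !inE; apply/negP => xv; apply: nsq; exists x.
Qed.

Lemma sum_sqr (g : F -> int) : \sum_(x : F) g (x ^+ 2) = \sum_(v : F) (1 + chi v) * g v.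
Proof.
rewrite (partition_big (fun x => x ^+ 2) xpredT) //=; apply: eq_bigr => v _.
rewrite -card_sqrt mulrC -natz mulr_natr -sumr_const.
rewrite [RHS](eq_bigl (fun x => x ^+ 2 == v)) => [|x]; last by rewrite inE.
by apply: eq_bigr => x /eqP ->.
Qed.

(** For [w != 0], replacing [w] by its inverse turns the term into [chi (1 + d * w)]. The sum of
    these over all [w] vanishes, and the missing term at 0 is 1. *)
Lemma sum_quadchar_mul d : d != 0 -> \sum_(w : F) chi (w * (w + d)) = -1.
Proof.
move=> d0; rewrite (bigD1 0) //= mul0r quadchar0 add0r.
have -> : \sum_(w : F | w != 0) chi (w * (w + d)) = \sum_(w : F | w != 0) chi (1 + d * w).
  rewrite (reindex_inj (@invr_inj _)) /=.
  rewrite (eq_bigl (fun w => w != 0)) => [|w]; last by rewrite invr_eq0.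
  apply: eq_bigr => w w0; rewrite -(quadchar_sqrM _ w0); congr (quadchar _).
  by field.
have := sum_quadchar; rewrite (reindex_inj (mulfI d0)) (reindex_inj (addrI d^-1)).
rewrite (bigD1 0) //= addr0 divff // quadchar1.
under eq_bigr => w _ do rewrite mulrDr divff //.
by move/eqP; rewrite addrC addr_eq0 => /eqP.
Qed.

Lemma sum_quadchar_quad (r s : F) : r != s -> \sum_(v : F) chi ((v - r) * (v - s)) = -1.
Proof.
rewrite -subr_eq0 => rs; rewrite (reindex_inj (addIr r)) -(sum_quadchar_mul rs).
by apply: eq_bigr => w _; rewrite addrK addrA.
Qed.

(** * The cubic sums and their transformations *)

Definition cubic_sum n : int := \sum_(y : F) chi (y * (y + 1) * (y + n)).

(** Substituting [y / n] for [y] takes [n^-3] out of the cubic, which is [n] up to a square. *)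
Lemma cubic_sumV n : n != 0 -> cubic_sum n^-1 = chi n * cubic_sum n.
Proof.
move=> n0; have nV : n^-1 != 0 by rewrite invr_eq0.
rewrite /cubic_sum (reindex_inj (mulfI nV)) big_distrr /=.
apply: eq_bigr => y _; rewrite -quadcharM -(quadchar_sqrM _ (expf_neq0 2 n0)).
by congr (quadchar _); field.
Qed.

(** The substitution [y -> - (y + 1)] swaps [y] and [y + 1] up to sign and turns the third factor
    into [- (y + n)]. *)
Lemma cubic_sumC n : cubic_sum (1 - n) = chi (-1) * cubic_sum n.
Proof.
rewrite /cubic_sum (reindex_inj (@oppr_inj _)) (reindex_inj (addIr 1)) big_distrr /=.
by apply: eq_bigr => y _; rewrite -quadcharM; congr (quadchar _); ring.
Qed.

(* For [x != 0], [chi (x * (x^2 + a x + b)) = chi (z + a)] with [z = x + b / x];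
   this is the 2-isogeny with kernel generated by (0, 0). *)
Lemma cubic_sum_isogeny a b : b != 0 ->
  \sum_(x : F) chi (x * (x ^+ 2 + a * x + b)) =
  \sum_(w : F) chi (w * (w ^+ 2 - 2 * a * w + (a ^+ 2 - 4 * b))).
Proof.
move=> b0; rewrite (bigD1 0) //= mul0r quadchar0 add0r.
have -> : \sum_(x : F | x != 0) chi (x * (x ^+ 2 + a * x + b)) =
          \sum_(x : F | x != 0) chi (x + b / x + a).
  apply: eq_bigr => x x0; rewrite -[RHS](quadchar_sqrM _ x0).
  by congr (quadchar _); field.
(* For fixed [z], [x + b / x = z] is quadratic in [x] with discriminant [z ^+ 2 - 4 * b]. *)
rewrite (partition_big (fun x => x + b / x) xpredT) //=.
transitivity (\sum_(z : F) (1 + chi (z ^+ 2 - 4 * b)) * chi (z + a)).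
  apply: eq_bigr => z _; rewrite -card_sqrt mulrC.
  rewrite (eq_bigr (fun=> chi (z + a))) => [|x /andP[_ /eqP-> //]].
  rewrite sumr_const -[_ *+ #|_|]mulr_natr natz; congr (_ * Posz _).
  (* [2 * x - z] is the square root of the discriminant belonging to the solution [x]. *)
  have inj : injective (fun x => 2 * x - z).
    by move=> x y /addIr; apply: mulfI.
  rewrite -(card_imset _ inj); apply: eq_card => t.
  rewrite !inE; apply/imsetP/eqP => [[x /andP[/= x0 /eqP <-] ->]|t2].
    by field.
  have bE : b = (z + t) / 2 * ((z - t) / 2).
    apply: (@mulfI _ 4).
      by rewrite (_ : 4 = 2 * 2) ?mulf_neq0 //; ring.
    have -> : 4 * b = z ^+ 2 - t ^+ 2 by rewrite t2; ring.
    by field.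
  have zt0 : (z + t) / 2 != 0.
    by apply: contraNneq b0 => e; rewrite bE e mul0r.
  exists ((z + t) / 2); last by field.
  rewrite unfold_in zt0 /=; apply/eqP; rewrite bE.
  have zt1 : z + t != 0 by apply: contraNneq zt0 => ->; rewrite mul0r.
  by field; apply/andP.
(* The sum of [chi (z + a)] alone vanishes; the rest is the right-hand side with [w = z + a]. *)
rewrite (eq_bigr (fun z => chi (z + a) + chi ((z ^+ 2 - 4 * b) * (z + a)))).
  2: by move=> z _; rewrite mulrDl mul1r quadcharM.
rewrite big_split /= -[RHS]add0r; congr (_ + _).
  by rewrite -[RHS]sum_quadchar (reindex_inj (addIr (- a))) /=;
     apply: eq_bigr => z _; rewrite subrK.
rewrite (reindex_inj (addIr (- a))) /=; apply: eq_bigr => w _.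
by congr (quadchar _); ring.
Qed.

(** The isogeny with [a = 5], [b = 4] takes [(x + 1) * (x + 4)] to [(w - 1) * (w - 9)]; negating the
    variable then produces [chi (-1)]. *)
Lemma cubic_sum9 : cubic_sum 9 = chi (-1) * cubic_sum 4.
Proof.
have four0 : 4 != 0 :> F by rewrite (_ : 4 = 2 * 2) ?mulf_neq0 //; ring.
transitivity (chi (-1) * \sum_(x : F) chi (x * (x ^+ 2 + 5 * x + 4))); last first.
  by congr (_ * _); apply: eq_bigr => x _; congr (quadchar _); ring.
rewrite cubic_sum_isogeny // /cubic_sum (reindex_inj (@oppr_inj _)) big_distrr /=.
by apply: eq_bigr => y _; rewrite -quadcharM; congr (quadchar _); ring.
Qed.

End QuadraticCharacter.

(** A change of variable in a count. Invertibility is asked on [B] only, since [r] will be a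
    homography with a pole. *)
Lemma card_can_in (T : finType) (B : {set T}) (r r' : T -> T) (P : pred T) :
  {in B, forall x, r x \in B} -> {in B, forall x, r' x \in B} ->
  {in B, cancel r r'} -> {in B, cancel r' r} ->
  #|[set x in B | P x]| = #|[set x in B | P (r x)]|.
Proof.
move=> rB r'B rK r'K.
have inj : {in [set x in B | P (r x)] &, injective r}.
  by move=> x y; rewrite !inE => /andP[xB _] /andP[yB _] e; rewrite -(rK x) // e rK.
rewrite -(card_in_imset inj); apply: eq_card => y; rewrite !inE.
apply/andP/imsetP => [[yB Py]|[x]].
  by exists (r' y); rewrite ?inE r'K ?r'B.
by rewrite inE => /andP[xB Px] ->; rewrite rB.
Qed.

(** * Counting the points where two quadratics are nonresidues *)

Section QuadraticCharacter.

Variable F : finFieldType.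
Hypothesis two_neq0 : 2%:R != 0 :> F.
Implicit Types x y z u v w : F.

Local Notation chi := (@quadchar F).

(** Summing over [v = u ^+ 2] with weight [1 + chi v] leaves a linear sum, which vanishes, and
    [chi g] times a quadratic one, which is -1. *)
Lemma sum_quadchar_sqr a g : a != 0 -> g != 0 ->
  \sum_(u : F) chi (a + g * u ^+ 2) = - chi g.
Proof.
move=> a0 g0; rewrite (sum_sqr two_neq0 (fun v => chi (a + g * v))).
rewrite (eq_bigr (fun v => chi (a + g * v) + chi g * chi (v * (v + a / g)))).
  rewrite big_split -big_distrr /= sum_quadchar_mul ?mulf_neq0 ?invr_eq0 //.
  have := sum_quadchar two_neq0.
  rewrite (reindex_inj (mulfI g0)) (reindex_inj (addrI (a / g))) /=.
  under eq_bigr => v _ do rewrite mulrDr mulrCA divff // mulr1.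
  by move=> ->; rewrite add0r mulrN1.
move=> v _; rewrite mulrDl mul1r -!(quadcharM two_neq0); congr (_ + quadchar _).
by field.
Qed.

(** [u] stands for [j / i] in the form [a i^2 + g j^2]: the first condition concerns the value of
    the form, the second the parity of the number of [i] with [i < |u i|]. *)
Definition nonresidue_set (a g : F) : {set F} :=
  [set u | (chi (a + g * u ^+ 2) == -1) && (chi (1 - u ^+ 2) == -1)].

(** With [v = u ^+ 2], the part weighted by [chi v] is the cubic sum after [v -> - v]. The other
    part is a quadratic with leading coefficient [- g] and roots [- (a / g)] and 1, distinct because
    [a + g != 0]. *)
Lemma sum_quadchar_sqr2 a g : a != 0 -> g != 0 -> a + g != 0 ->
  \sum_(u : F) chi ((a + g * u ^+ 2) * (1 - u ^+ 2)) =
  chi g * cubic_sum (- (a / g)) - chi (- g).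
Proof.
move=> a0 g0 ag.
rewrite (sum_sqr two_neq0 (fun v => chi ((a + g * v) * (1 - v)))).
under eq_bigr => v _ do rewrite mulrDl mul1r -(quadcharM two_neq0).
rewrite big_split [LHS]addrC /=; congr (_ + _).
  rewrite (reindex_inj (@oppr_inj _)) /cubic_sum big_distrr /=; apply: eq_bigr => y _.
  by rewrite -(quadcharM two_neq0); congr (quadchar _); field.
have rs : - (a / g) != 1.
  apply: contraNneq ag => e; rewrite (_ : a = - g * (- (a / g))); last by field.
  by rewrite e; apply/eqP; ring.
transitivity (chi (- g) * -1); last by rewrite mulrN1.
rewrite -(sum_quadchar_quad two_neq0 rs) big_distrr /=.
apply: eq_bigr => v _.
by rewrite -(quadcharM two_neq0); congr (quadchar _); field.
Qed.

(** The product of the two factors [1 - chi] is 4 on the set and 0 off it, except possibly at zeros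
    of one of the quadratics; these give the last two terms. *)
Lemma card_nonresidue_set a g : a != 0 -> g != 0 -> a + g != 0 ->
  4 * #|nonresidue_set a g|%:Z =
  #|F|%:Z + chi g + chi (-1) - chi (- g) + chi g * cubic_sum (- (a / g))
  - (1 + chi (- (a / g))) * (1 - chi ((a + g) / g)) - 2 * (1 - chi (a + g)).
Proof.
move=> a0 g0 ag.
have S : \sum_(u : F) (1 - chi (a + g * u ^+ 2)) * (1 - chi (1 - u ^+ 2)) =
  #|F|%:Z + chi g + chi (-1) + (chi g * cubic_sum (- (a / g)) - chi (- g)).
  rewrite -sum_quadchar_sqr2 //.
  rewrite (eq_bigr (fun u => 1 - chi (a + g * u ^+ 2) - chi (1 + -1 * u ^+ 2) +
     chi ((a + g * u ^+ 2) * (1 - u ^+ 2)))).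
    rewrite big_split /= sumrB sumrB !sum_quadchar_sqr ?oner_eq0 ?oppr_eq0 ?oner_eq0 //.
    by rewrite sumr_const natz !opprK.
  by move=> u _; rewrite (quadcharM two_neq0) mulN1r; ring.
have E : \sum_(u : F) (1 - chi (a + g * u ^+ 2)) * (1 - chi (1 - u ^+ 2)) =
  \sum_(u : F) (if u \in nonresidue_set a g then 4 else 0) +
  (\sum_(u : F) (if u ^+ 2 == - (a / g) then 1 - chi ((a + g) / g) else 0) +
   \sum_(u : F) (if u ^+ 2 == 1 then 1 - chi (a + g) else 0)).
  rewrite -!big_split /=; apply: eq_bigr => u _; rewrite inE.
  have e1 : (u ^+ 2 == - (a / g)) = (chi (a + g * u ^+ 2) == 0).
    rewrite quadchar_eq0 -(inj_eq (mulfI g0)) -(inj_eq (addrI a)).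
    by congr (_ == _); field.
  have e2 : (u ^+ 2 == 1) = (chi (1 - u ^+ 2) == 0).
    by rewrite quadchar_eq0 subr_eq0 eq_sym.
  have [h1|h1] := boolP (u ^+ 2 == - (a / g)).
    have := h1; rewrite e1 => /eqP ->; rewrite (eqP h1).
    have -> : 1 - - (a / g) = (a + g) / g by field.
    (* A common zero of the two quadratics would force [a + g = 0]. *)
    case: ifP => [/eqP e|_]; last by rewrite /=; ring.
    have : a + g = g * (1 - - (a / g)) by field.
    by rewrite e subrr mulr0 => /eqP; rewrite (negPf ag).
  have [h2|h2] := boolP (u ^+ 2 == 1).
    by have := h2; rewrite e2 => /eqP ->; rewrite (eqP h2) mulr1 andbF /=; ring.
  move: h1 h2; rewrite e1 e2 !quadchar_eq0.
  by move=> /quadcharP[] -> /quadcharP[] ->.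
move: S; rewrite E -!big_mkcond !sumr_const.
rewrite -[_ *+ #|nonresidue_set a g|]mulr_natr.
have cs v : #|[pred u | u ^+ 2 == v]|%:Z = 1 + chi v.
  by rewrite -card_sqrt //; congr Posz; apply: eq_card => u; rewrite !inE.
rewrite -[_ *+ #|[pred u | u ^+ 2 == - (a / g)]|]mulr_natr.
rewrite -[_ *+ #|[pred u | u ^+ 2 == 1]|]mulr_natr !natz !cs quadchar1.
by move=> H; rewrite -addrA in H; rewrite mulrC in H; lia.
Qed.

Lemma card_nonresidue_set_mod4 : 3%:R != 0 :> F ->
  exists k, #|nonresidue_set 3 1| =
    (4 * k + 2 * ((chi 3%R == -1%R) && (chi (-2)%R == -1%R)))%N.
Proof.
move=> three_neq0.
have q4 : 4 != 0 :> F by rewrite (_ : 4 = 2 * 2) ?mulf_neq0 //; ring.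
have q6 : 6 != 0 :> F by rewrite (_ : 6 = 2 * 3) ?mulf_neq0 //; ring.
have q8 : 8 != 0 :> F by rewrite (_ : 8 = 2 * 4) ?mulf_neq0 //; ring.
(* On the projective line, the map [r] below permutes 1, infinity, -1 cyclically, and likewise 0, 3,
   -3; [gen] removes these two orbits. *)
pose gen u := [&& u != 0, u + 1 != 0, u - 1 != 0, u + 3 != 0 & u - 3 != 0].
pose B := [set u | gen u && (chi (3 + u ^+ 2) == -1)].
pose m u := chi (1 - u ^+ 2) == -1.
(* [r] is multiplication by a cube root of unity on [u + sqrt (-3)], up to scaling. *)
pose r u := (u + 3) / (1 - u).
pose r' u := (u - 3) / (1 + u).
have genP u : u \in B ->
  [/\ u != 0, 1 - u != 0, 1 + u != 0, u + 3 != 0 & u - 3 != 0].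
  rewrite inE => /andP[/and5P[? h1 h2 ? ?] _]; split=> //.
    by rewrite -oppr_eq0 opprB.
  by rewrite addrC.
have opp_B : {in B, forall u, - u \in B}.
  move=> u uB; have [h1 h2 h3 h4 h5] := genP u uB; move: uB.
  rewrite !inE sqrrN => /andP[_ ->]; rewrite andbT /gen oppr_eq0 h1 /=.
  apply/and4P; split; first by rewrite addrC.
  - by rewrite -opprD oppr_eq0 addrC.
  - by rewrite addrC -opprB oppr_eq0.
  - by rewrite -opprD oppr_eq0.
(* Conjugation by the sign change inverts [r]. *)
have opp_r u : r' u = - r (- u) by rewrite /r /r' -mulNr; congr (_ / _); ring.
have rB : {in B, forall u, r u \in B}.
  move=> u uB; have [h1 h2 h3 h4 h5] := genP u uB; move: uB; rewrite !inE.
  move=> /andP[_ c]; apply/andP; split; last first.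
    rewrite (_ : 3 + _ = (2 / (1 - u)) ^+ 2 * (3 + u ^+ 2)); last by rewrite /r; field.
    by rewrite quadchar_sqrM // mulf_neq0 ?invr_eq0.
  apply/and5P; split; rewrite ?mulf_neq0 ?invr_eq0 //.
  - by rewrite (_ : r u + 1 = 4 / (1 - u)) ?mulf_neq0 ?invr_eq0 // /r; field.
  - by rewrite (_ : r u - 1 = 2 * (1 + u) / (1 - u)) ?mulf_neq0 ?invr_eq0 // /r; field.
  - by rewrite (_ : r u + 3 = - 2 * (u - 3) / (1 - u)) ?mulf_neq0 ?oppr_eq0 ?invr_eq0 //
       /r; field.
  - by rewrite (_ : r u - 3 = 4 * u / (1 - u)) ?mulf_neq0 ?invr_eq0 // /r; field.
have r'B : {in B, forall u, r' u \in B}.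
  by move=> u uB; rewrite opp_r; apply/opp_B/rB/opp_B.
have rK : {in B, cancel r r'}.
  move=> u uB; have [h1 h2 h3 h4 h5] := genP u uB.
  rewrite /r' (_ : 1 + r u = 4 / (1 - u)); last by rewrite /r; field.
  by rewrite /r; field; rewrite h2 q4.
have r'K : {in B, cancel r' r}.
  by move=> u /opp_B /rK; rewrite opp_r -(opp_r u) => /oppr_inj.
have rr : {in B, forall u, r (r u) = r' u}.
  move=> u uB; have [h1 h2 h3 h4 h5] := genP u uB.
  rewrite {1}/r (_ : 1 - r u = - 2 * (1 + u) / (1 - u)); last by rewrite /r; field.
  by rewrite /r /r'; field; rewrite h3 h2 oppr_eq0.
have m_opp u : m (- u) = m u by rewrite /m sqrrN.
(* The three values [1 - u ^+ 2] along an orbit of [r] have product [8 ^+ 2], so [m] holds at none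
   or two of its points. *)
have xorm : {in B, forall u, m u (+) m (r u) (+) m (r' u) = false}.
  move=> u uB; have [h1 h2 h3 h4 h5] := genP u uB.
  have nz v : v \in B -> 1 - v ^+ 2 != 0.
    move=> /genP[_ ? ? _ _]; rewrite (_ : 1 - v ^+ 2 = (1 - v) * (1 + v)); last by ring.
    by rewrite mulf_neq0.
  have : chi ((1 - u ^+ 2) * (1 - r u ^+ 2) * (1 - r' u ^+ 2)) = 1.
    rewrite (_ : _ * _ = 8 ^+ 2) ?quadchar_sqr //.
    by rewrite /r /r'; field; rewrite h2 h3.
  rewrite !quadcharM // /m.
  by case: (quadcharP (nz _ uB)) => ->; case: (quadcharP (nz _ (rB _ uB))) => ->;
     case: (quadcharP (nz _ (r'B _ uB))) => ->.
(* [C] takes from each orbit where [m] holds twice the point where it fails. So [m] holds at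
   [2 * #|C|] points, and the sign change makes [#|C|] even. *)
pose C := [set u in B | ~~ m u && m (r u)].
have C_even : ~~ odd #|C|.
  apply: (@card_free_involution _ -%R); first exact: opprK.
    move=> u /setIdP[uB mu]; apply/setIdP; split; first exact: opp_B.
    rewrite m_opp -(m_opp (r _)) -opp_r.
    by have := xorm u uB; move: mu; case: (m u); case: (m (r u)); case: (m (r' u)).
  by move=> u; rewrite inE => /andP[/genP[u0 _ _ _ _] _]; apply: oppr_neq.
have card1 : #|[set u in B | m u && ~~ m (r u)]| = #|C|.
  rewrite (card_can_in _ r'B rB r'K rK); apply: eq_card => u.
  rewrite !(in_set (fun u => (u \in B) && _)); case uB: (u \in B) => //=; rewrite r'K //.
  by have := xorm u uB; case: (m u); case: (m (r u)); case: (m (r' u)).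
have card2 : #|[set u in B | m u && m (r u)]| = #|C|.
  rewrite (card_can_in _ rB r'B rK r'K); apply: eq_card => u.
  rewrite !(in_set (fun u => (u \in B) && _)); case uB: (u \in B) => //=; rewrite rr //.
  by have := xorm u uB; case: (m u); case: (m (r u)); case: (m (r' u)).
have cardB : #|[set u in B | m u]| = (2 * #|C|)%N.
  rewrite -(cardsID [set u | m (r u)]) mul2n -addnn -{1}card2 -card1.
  by congr (_ + _)%N; apply: eq_card => u; rewrite !inE; case: (gen u); case: (m u); 
     case: (m (r u)); rewrite ?andbF ?andbT.
exists #|C|./2.
(* Apart from [B], only 3 and -3 can contribute: at 0, 1 and -1 the second symbol is 1 or 0. *)
rewrite -(cardsID [set 3; -3]) addnC; congr (_ + _)%N.
  have -> : (4 * #|C|./2 = 2 * #|C|)%N by rewrite -{2}(even_halfK C_even); lia.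
  rewrite -cardB; apply: eq_card => u; rewrite !inE mul1r -/(m u).
  case mu: (m u); rewrite ?andbF // !andbT.
  have u0 : u != 0.
    by apply: contraTneq mu => ->; rewrite /m expr0n subr0 quadchar1.
  have um : (u + 1) * (u - 1) != 0.
    apply: contraTneq mu => e; rewrite /m (_ : 1 - _ = 0) ?quadchar0 //.
    by rewrite -oppr0 -e; ring.
  move: um; rewrite mulf_eq0 negb_or /gen u0 => /andP[-> ->] /=.
  by rewrite negb_or subr_eq0 addr_eq0 [X in X && _]andbC.
have mem3 u : u ^+ 2 = 9 ->
  (u \in nonresidue_set 3 1) = (chi 3 == -1) && (chi (-2) == -1).
  move=> u2; rewrite inE u2.
  have -> : 3 + 1 * 9 = 2 ^+ 2 * 3 :> F by ring.
  have -> : 1 - 9 = 2 ^+ 2 * -2 :> F by ring.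
  by rewrite !quadchar_sqrM.
have m9 : 3 ^+ 2 = 9 :> F by ring.
have -> : nonresidue_set 3 1 :&: [set 3; -3] =
  if (chi 3 == -1) && (chi (-2) == -1) then [set -3; 3] else set0.
  apply/setP => u; rewrite in_setI in_set2.
  have [uE|uN] := boolP ((u == 3) || (u == -3)).
    rewrite andbT mem3; first by case: ifP => _; rewrite ?inE // orbC uE.
    by case/orP: uE => /eqP->; rewrite ?sqrrN.
  by rewrite andbF; case: ifP => _; rewrite ?inE // orbC (negPf uN).
by case: ifP => _; rewrite ?cards0 // cards2 oppr_neq.
Qed.

End QuadraticCharacter.

(** * Half systems of a prime field *)

Section PrimeField.

Variable p : nat.
Hypothesis p_pr : prime p.
Local Notation F := 'F_p.
Local Notation chi := (@quadchar F).
Implicit Types x y z u a b : F.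

Lemma natr_Fp_eq0 (n : nat) : (n%:R == 0 :> F) = (p %| n)%N.
Proof. by rewrite (dvdn_pcharf (pchar_Fp p_pr)). Qed.

Lemma intr_Fp_eq0 (n : int) : (n%:~R == 0 :> F) = (p %| n)%Z.
Proof.
rewrite dvdzE /=; case: n => n; first exact: natr_Fp_eq0.
by rewrite NegzE mulrNz oppr_eq0 abszN; apply: natr_Fp_eq0.
Qed.

Lemma legendreE (n : int) : legendre p n = chi n%:~R.
Proof.
rewrite /legendre /quadchar -intr_Fp_eq0; case: eqP => // _.
have eqmod (i : nat) : (i%:Z ^+ 2 == n %[mod p])%Z = (i%:R ^+ 2 == n%:~R :> F).
  by rewrite eqz_mod_dvd -intr_Fp_eq0 intrB subr_eq0 rmorphXn.
congr (if _ then _ else _); apply/existsP/existsP => [[i]|[y]].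
  by rewrite eqmod => h; exists (i%:R).
rewrite -[y]natr_Zp -eqmod => h.
by exists (cast_ord (Fp_cast p_pr) y).
Qed.

Lemma ltn_Fp x : (x < p)%N.
Proof. by rewrite -[X in (_ < X)%N](Fp_cast p_pr) ltn_ord. Qed.

Lemma val_Fp_eq0 x : (x == 0) = (x == 0%N :> nat).
Proof. by rewrite -(inj_eq val_inj). Qed.

(** A case split instead of a remainder by the variable [p] keeps later comparisons linear. *)
Lemma val_FpD x y :
  (x + y)%R = (if (x + y < p)%N then (x + y)%N else (x + y - p)%N) :> nat.
Proof.
rewrite -[x in LHS]natr_Zp -[y in LHS]natr_Zp -natrD val_Fp_nat //.
have := ltn_Fp x; have := ltn_Fp y; case: (ltnP (x + y) p) => [lt _ _|ge yp xp].
  by rewrite modn_small.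
by rewrite -{1}(subnK ge) modnDr modn_small //; lia.
Qed.

Lemma val_FpN x : x != 0 -> (- x)%R = (p - x)%N :> nat.
Proof.
rewrite val_Fp_eq0 => x0; have xp := ltn_Fp x.
rewrite -[X in (- X)%R]natr_Zp -[(- _)%R]add0r.
have -> : (0 - (x : nat)%:R = (p - x)%:R :> F)%R.
  by rewrite natrB ?(ltnW xp) // pchar_Fp_0.
by rewrite val_Fp_nat // modn_small //; lia.
Qed.

Definition lower_half x := (0 < x)%N && (x.*2 < p)%N.
(** Sign and representative of [x] with respect to the half system 1, ..., (p - 1) / 2; at 0 they
    are -1 and 0. *)
Definition half_sign x : int := if lower_half x then 1 else -1.
Definition half_abs x : F := if lower_half x then x else - x.

Hypothesis p_odd : odd p.

Lemma two_neq0_Fp : 2%:R != 0 :> F.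
Proof.
rewrite natr_Fp_eq0 dvdn_prime2 //; apply: contraTneq p_odd => ->.
by [].
Qed.

Lemma half_neq0 x : lower_half x -> x != 0.
Proof. by rewrite val_Fp_eq0 => /andP[]; lia. Qed.

Lemma halfN x : x != 0 -> lower_half (- x) = ~~ lower_half x.
Proof.
move=> x0; rewrite /lower_half val_FpN //; move: x0 (ltn_Fp x); rewrite val_Fp_eq0.
by move: p_odd; lia.
Qed.

Lemma half_absP x : x != 0 -> lower_half (half_abs x).
Proof. by move=> x0; rewrite /half_abs; case: ifP => // /negbT; rewrite halfN. Qed.

Lemma half_abs_id x : lower_half x -> half_abs x = x.
Proof. by rewrite /half_abs => ->. Qed.

Lemma half_absN x : half_abs (- x) = half_abs x.
Proof.
have [->|x0] := eqVneq x 0; first by rewrite oppr0.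
by rewrite /half_abs halfN //; case: lower_half; rewrite //= opprK.
Qed.

Lemma half_abs_sqr x : half_abs x ^+ 2 = x ^+ 2.
Proof. by rewrite /half_abs; case: ifP; rewrite ?sqrrN. Qed.

Lemma half_absE x : (half_sign x)%:~R * half_abs x = x.
Proof.
by rewrite /half_sign /half_abs; case: ifP; rewrite ?mul1r // mulN1r opprK.
Qed.

Lemma val_half_abs x : x != 0 -> half_abs x = minn x (p - x) :> nat.
Proof.
move=> x0; move: (x0) (ltn_Fp x); rewrite val_Fp_eq0 /half_abs.
case: ifP; rewrite /lower_half ?val_FpN //; move: p_odd; lia.
Qed.

(* With absolute values taken in (-p/2, p/2), this is the sign of
   sin^2 (pi (a+b)/p) - sin^2 (pi (a-b)/p) = sin (2 pi a/p) sin (2 pi b/p). *)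
Lemma half_abs_lt a b : a != 0 -> b != 0 -> b - a != 0 -> a + b != 0 ->
  (half_abs (b - a)%R < half_abs (a + b)%R)%N = (lower_half a == lower_half b).
Proof.
move=> a0 b0 ba ab; rewrite !val_half_abs //.
move: (ltn_Fp a) (ltn_Fp b) a0 b0 ba ab; rewrite !val_Fp_eq0.
move=> ap bp a0 b0; rewrite !val_FpD val_FpN ?val_Fp_eq0 // /lower_half.
by move: p_odd; case: ifP; case: ifP; lia.
Qed.

(** Multiplication by [a] permutes the classes [{x, - x}] with [x != 0]; [a^-1] gives the inverse
    permutation. *)
Lemma reindex_half_abs (R : Type) (idx : R) (op : Monoid.com_law idx) a (G : F -> R) :
  a != 0 ->
  \big[op/idx]_(y | lower_half y) G y = \big[op/idx]_(x | lower_half x) G (half_abs (a * x)).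
Proof.
move=> a0; have absM b x : half_abs (b * half_abs x) = half_abs (b * x).
  by rewrite {2}/half_abs; case: ifP => //; rewrite mulrN half_absN.
rewrite (reindex_onto (fun x => half_abs (a * x)) (fun y => half_abs (a^-1 * y))).
  apply: eq_bigl => x; rewrite absM mulKf //.
  have [->|x0] := eqVneq x 0; first by rewrite mulr0 /half_abs oppr0.
  rewrite half_absP ?mulf_neq0 //=; apply/eqP/idP => [<-|/half_abs_id //].
  exact: half_absP.
by move=> y yH; rewrite absM mulVKf // half_abs_id.
Qed.

Lemma card_half_sym (A : {set F}) : 0 \notin A -> {in A, forall x, - x \in A} ->
  #|A| = (2 * #|[set x in A | lower_half x]|)%N.
Proof.
move=> A0 AN; rewrite -(cardsID [set x | lower_half x]) mul2n -addnn.
congr (_ + _)%N; first by apply: eq_card => x; rewrite !inE.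
rewrite -(card_imset _ (@oppr_inj F)); apply: eq_card => x; rewrite !inE.
have nz y : y \in A -> y != 0 by apply: contraTneq => ->.
apply/imsetP/andP => [[y]|[xA xH]].
  by rewrite !inE => /andP[yH yA] ->; rewrite AN // halfN ?yH ?nz.
by exists (- x); rewrite ?opprK // !inE AN // halfN ?nz // xH.
Qed.

Lemma card_half : #|[set x | lower_half x]| = (#|F|.-1./2)%N.
Proof.
have -> : #|F|.-1 = #|[set~ (0 : F)]| by rewrite cardsC1.
rewrite [#|[set~ 0]|]card_half_sym ?mul2n ?doubleK; last first.
- by move=> x; rewrite !in_setC1 oppr_eq0.
- by rewrite in_setC1 eqxx.
apply: eq_card => x; rewrite !inE.
by case: (boolP (lower_half x)) => [/half_neq0->|]; rewrite ?andbF.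
Qed.

(** Multiplying the half system by [a] permutes it up to signs. Comparing products, the product of
    the signs equals the power of [a] in Euler's criterion. *)
Lemma gauss_lemma a : a != 0 -> \prod_(x | lower_half x) half_sign (a * x) = chi a.
Proof.
move=> a0; set s := \prod_(x | _) _.
have sE : s%:~R = (chi a)%:~R :> F.
  have P0 : \prod_(x | lower_half x) x != 0 :> F.
    by rewrite prodf_seq_neq0; apply/allP => x _; apply/implyP/half_neq0.
  apply: (mulIf P0); rewrite -euler_criterion ?two_neq0_Fp // -card_half.
  rewrite {1}(reindex_half_abs _ _ a0) /s rmorph_prod -big_split /=.
  under eq_bigr => x _ do rewrite half_absE.
  rewrite big_split prodr_const; congr (_ ^+ _ * _).
  by apply: eq_card => x; rewrite !inE.
have s1 : s = 1 \/ s = -1.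
  rewrite /s; elim/big_rec: _ => [|x e _ [] ->]; [by left| |];
  by rewrite /half_sign; case: lower_half; rewrite ?mulrN ?mulr1 ?opprK; auto.
have n1 : -1 != 1 :> F by rewrite oppr_neq ?two_neq0_Fp ?oner_eq0.
have n2 : 1 != -1 :> F by rewrite eq_sym.
by move: sE; case: s1 => ->; case: (quadcharP a0) => -> // /eqP;
  rewrite /= ?(negPf n1) ?(negPf n2).
Qed.

(** With [c = (1 + u) / 2] and [d = (1 - u) / 2], [x = c x + d x] and [x u = c x - d x]. So
    [|x| < |x u|] exactly when [c x] and [d x] lie in opposite halves, and Gauss's lemma gives
    [chi (c d) = chi (1 - u ^+ 2)]. *)
Lemma prod_lt_half_abs u : lower_half u ->
  \prod_(x | lower_half x) (if (x < half_abs (x * u)%R)%N then -1 else 1) =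
  if chi (1 - u ^+ 2) == -1 then -1 else 1 :> int.
Proof.
move=> uH; have two0 := two_neq0_Fp; have u0 := half_neq0 uH.
(* Here [d] would vanish; both sides are 1. *)
have [->|u1] := eqVneq u 1.
  rewrite expr1n subrr quadchar0 /= big1 // => x xH.
  by rewrite mulr1 half_abs_id // ltnn.
have u_1 : 1 + u != 0.
  apply: contraTneq uH => e.
  have -> : u = - 1 by apply/eqP; rewrite -addr_eq0 addrC e.
  rewrite halfN ?oner_eq0 // negbK /lower_half -(natr_Zp 1) val_Fp_nat //.
  by rewrite modn_small ?prime_gt1 //; apply: odd_prime_gt2.
have u1' : 1 - u != 0 by rewrite subr_eq0 eq_sym.
pose c := (1 + u) / 2; pose d := (1 - u) / 2.
have c0 : c != 0 by rewrite mulf_neq0 ?invr_eq0.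
have d0 : d != 0 by rewrite mulf_neq0 ?invr_eq0.
transitivity (\prod_(x | lower_half x) (half_sign (c * x) * half_sign (d * x))).
  apply: eq_bigr => x xH; have x0 := half_neq0 xH.
  have bE : c * x + - (d * x) = x * u by rewrite /c /d; field.
  have aE : - (d * x) - c * x = - x by rewrite /c /d; field.
  have : (half_abs (- x)%R < half_abs (x * u)%R)%N =
         (lower_half (c * x) == lower_half (- (d * x))).
    by rewrite -bE -aE half_abs_lt ?aE ?bE ?oppr_eq0 ?mulf_neq0 ?invr_eq0.
  rewrite (half_absN x) half_abs_id // halfN ?(mulf_neq0 d0) // => ->.
  rewrite /half_sign.
  by case: (lower_half (c * x)); case: (lower_half (d * x)).
rewrite big_split /= !gauss_lemma // -quadcharM //.
have -> : c * d = (2^-1) ^+ 2 * (1 - u ^+ 2) by rewrite /c /d; field.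
rewrite quadchar_sqrM ?invr_eq0 //.
have : 1 - u ^+ 2 != 0.
  by rewrite (_ : 1 - u ^+ 2 = (1 - u) * (1 + u)) ?mulf_neq0 //; ring.
by move/quadcharP => [] ->.
Qed.

(** * Products of quadratic forms over pairs *)

Definition half_pairs : {set F * F} :=
  [set t | [&& lower_half t.1, lower_half t.2 & (t.1 < t.2)%N]].

Lemma prod_half_pairs (G : F -> F -> int) :
  \prod_(t in half_pairs) G t.1 t.2 =
  \prod_(x | lower_half x) \prod_(y | lower_half y) (if (x < y)%N then G x y else 1).
Proof.
rewrite pair_big_dep /= [RHS]big_mkcond [LHS]big_mkcond /=.
by apply: eq_bigr => -[x y] _; rewrite inE /=; case: (lower_half x); case: (lower_half y);
  case: ltnP.
Qed.

(** Putting [y = |x u|] makes the symbol [chi (a + g u^2)], free of [x]. The product over [x] then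
    depends on [chi (1 - u^2)], and the exponent counts the lower half of the symmetric set
    [nonresidue_set a g]. *)
Lemma prod_diagonal_form (a g : F) :
  \prod_(t in half_pairs)
     (if a * t.1 ^+ 2 + g * t.2 ^+ 2 == 0 then 1
      else chi (a * t.1 ^+ 2 + g * t.2 ^+ 2)) =
  (-1) ^+ (#|nonresidue_set a g|./2).
Proof.
have two0 := two_neq0_Fp.
rewrite (prod_half_pairs (fun x y => if a * x ^+ 2 + g * y ^+ 2 == 0 then 1
      else chi (a * x ^+ 2 + g * y ^+ 2))).
transitivity (\prod_(x | lower_half x) \prod_(u | lower_half u)
  (if (x < half_abs (x * u)%R)%N && (chi (a + g * u ^+ 2) == -1) then -1 else 1 : int)).
  apply: eq_bigr => x xH; have x0 := half_neq0 xH.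
  rewrite (reindex_half_abs _ _ x0); apply: eq_bigr => u uH.
  rewrite half_abs_sqr (_ : a * _ + _ = x ^+ 2 * (a + g * u ^+ 2)); last by ring.
  rewrite quadchar_sqrM // mulf_eq0 sqrf_eq0 (negPf x0) /=.
  case: ifP => //= _; case: eqVneq => [->|/quadcharP[] -> //].
  by rewrite quadchar0.
rewrite exchange_big /=.
rewrite (@card_half_sym (nonresidue_set a g)).
- rewrite mul2n doubleK -prodr_const [RHS]big_mkcond [LHS]big_mkcond /=.
  apply: eq_bigr => u _; rewrite !inE andbC; case uH: (lower_half u) => //=.
  case: eqP => _ /=; last by under eq_bigr => x _ do rewrite andbF; rewrite big1.
  by rewrite -prod_lt_half_abs //; apply: eq_bigr => x _; rewrite andbT.
- by rewrite inE expr0n subr0 quadchar1 andbF.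
- by move=> x; rewrite !inE sqrrN.
Qed.

(** [phi] preserves [half_pairs] by [half_abs_lt]. It is injective: [y - x] and [x + y] up to signs
    fix the pair up to sign and order, which the half system and [x < y] settle. *)
Lemma prod_symmetric_form (G : F -> F -> int) :
  \prod_(t in half_pairs) G (half_abs (t.2 - t.1)) (half_abs (t.1 + t.2)) =
  \prod_(t in half_pairs) G t.1 t.2.
Proof.
have two0 := two_neq0_Fp.
pose phi (t : F * F) := (half_abs (t.2 - t.1), half_abs (t.1 + t.2)).
have halfNN x : lower_half x -> lower_half (- x) -> False.
  by move=> xH; rewrite halfN ?xH //; apply: half_neq0 xH.
have inj : {in half_pairs &, injective phi}.
  have absE x y : half_abs x = half_abs y -> x = y \/ x = - y.
    rewrite /half_abs; do 2 case: ifP => _; move=> e; [left|right|right|left] => //.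
    - by rewrite -e opprK.
    - exact: oppr_inj.
  move=> [x y] [x' y']; rewrite !inE /= => /and3P[xH yH lt] /and3P[xH' yH' lt'].
  case=> /absE e1 /absE e2.
  have xE : x = (x + y - (y - x)) / 2 by field.
  have yE : y = (x + y + (y - x)) / 2 by field.
  have [] : (x = x' /\ y = y') \/ [\/ y = - y', y = - x' | (x = y' /\ y = x')].
  - case: e1 e2 => e1 [] e2; [left|right; apply: Or32|right; apply: Or33|right; apply: Or31].
    + by split; [rewrite [LHS]xE|rewrite [LHS]yE]; rewrite e1 e2; field.
    + by rewrite [LHS]yE e1 e2; field.
    + by split; [rewrite [LHS]xE|rewrite [LHS]yE]; rewrite e1 e2; field.
    + by rewrite [LHS]yE e1 e2; field.
  - by case=> -> ->.
  - case=> [e|e|[e1' e2']].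
    + by case: (halfNN y'); rewrite // -e.
    + by case: (halfNN x'); rewrite // -e.
    + by move: lt lt'; rewrite e1' e2'; lia.
have im : phi @: half_pairs = half_pairs.
  apply/eqP; rewrite eqEcard card_in_imset // leqnn andbT.
  apply/subsetP => _ /imsetP[[x y] + ->]; rewrite !inE /= => /and3P[xH yH lt].
  have yx0 : y - x != 0 by apply: contraTneq lt => /subr0_eq->; rewrite ltnn.
  have xy0 : x + y != 0.
    by apply/negP => /eqP e; case: (halfNN y); rewrite // (_ : - y = x) //;
       apply/eqP; rewrite eq_sym -addr_eq0 e.
  rewrite !half_absP // half_abs_lt ?xH ?yH //; exact: half_neq0.
by rewrite -[in RHS]im big_imset.
Qed.

(** * Integer sums and products carried to the prime field *)

Lemma form_productE (f : int * int * int) :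
  form_product f p =
  \prod_(t in half_pairs)
    (let q := f.1.1%:~R * t.1 ^+ 2 + f.1.2%:~R * (t.1 * t.2) + f.2%:~R * t.2 ^+ 2 in
     if q == 0 then 1 else chi q).
Proof.
rewrite (prod_half_pairs (fun x y =>
    (let q := f.1.1%:~R * x ^+ 2 + f.1.2%:~R * (x * y) + f.2%:~R * y ^+ 2 in
     if q == 0 then 1 else chi q))) /=.
(* The carrier of ['F_p] is an ordinal type whose bound equals [p] only through [Fp_cast]. *)
have bij (n m : nat) (e : n = m) (P : {pred 'I_m}) :
  {on P, bijective (cast_ord e)}.
  by apply: onW_bij; exists (cast_ord (esym e)); [apply: cast_ordK|apply: cast_ordKV].
rewrite /form_product (reindex _ (bij _ _ (Fp_cast p_pr) _)) [RHS]big_mkcond /=.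
apply: eq_bigr => x _.
rewrite (reindex _ (bij _ _ (Fp_cast p_pr) _)) big_mkcond /=.
have termE y : ~~ (p %| qform f (x : nat) (y : nat))%Z =
    (f.1.1%:~R * x ^+ 2 + f.1.2%:~R * (x * y) + f.2%:~R * y ^+ 2 != 0 :> F) /\
  legendre p (qform f (x : nat) (y : nat)) =
    chi (f.1.1%:~R * x ^+ 2 + f.1.2%:~R * (x * y) + f.2%:~R * y ^+ 2).
  rewrite legendreE -intr_Fp_eq0 /qform !intrD !intrM.
  by rewrite [(x : nat)%:~R]natr_Zp [(y : nat)%:~R]natr_Zp.
case xH: (lower_half x); last first.
  rewrite big1 // => y _; case: ifP => // /and4P[x0 lt y2 _].
  by move: xH; rewrite /lower_half; lia.
rewrite [RHS]big_mkcond; apply: eq_bigr => y _.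
have [-> ->] := termE y; have /andP[x0 _] := xH; rewrite x0 /lower_half /=.
case: (ltnP x y) => [xy|_]; last by rewrite if_same.
by rewrite (leq_ltn_trans (leq0n x) xy) /=; case: (y.*2 < p)%N => //=; case: eqP.
Qed.

Lemma F01_Fp (n : rat) : (denq n)%:~R != 0 :> F ->
  F01 p n = cubic_sum ((numq n)%:~R / (denq n)%:~R : F).
Proof.
move=> d0; set w : F := _ / _.
rewrite (@F01E p n (w : nat)) //; last first.
- apply/eqP; rewrite eqz_mod_dvd -intr_Fp_eq0 // intrB intrM subr_eq0.
  by rewrite [_%:~R]natr_Zp mulfVK.
- by rewrite -intr_Fp_eq0.
pose g (y : nat) := chi (y%:R * (y%:R + 1) * (y%:R + w)).
have gE (y : nat) : legendre p (y%:Z * (y%:Z + 1) * (y%:Z + (w : nat))) = g y.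
  by rewrite legendreE // !intrM !intrD [(w : nat)%:~R]natr_Zp.
under eq_bigr => y _ do rewrite gE.
have p_gt0 := prime_gt0 p_pr.
(* The term [y = p] is moved to the front as the term [y = 0]. *)
rewrite big_nat_recr //= [LHS]addrC -[g p](_ : g 0%N = _); last first.
  by rewrite /g pchar_Fp_0.
rewrite -(big_ltn (F := g)) // big_mkord.
rewrite (reindex (cast_ord (Fp_cast p_pr))) /=; last first.
  by apply: onW_bij; exists (cast_ord (esym (Fp_cast p_pr)));
     [apply: cast_ordK|apply: cast_ordKV].
by apply: eq_bigr => y _; rewrite /g /= natr_Zp.
Qed.

End PrimeField.

(** * The character at -1, 2 and 3 *)

Lemma prod_interval_sign (lo hi n : nat) :
  \prod_(0 <= k < n) (if (lo <= k < hi)%N then -1 else 1) =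
  (-1) ^+ (minn hi n - lo) :> int.
Proof.
elim: n => [|n IHn]; first by rewrite big_geq // minn0 sub0n expr0.
rewrite big_nat_recr //= IHn; case: ifP => h.
  by rewrite -exprSr; congr (_ ^+ _); lia.
by rewrite mulr1; congr (_ ^+ _); lia.
Qed.

Section PrimeField.

Variable p : nat.
Hypothesis p_pr : prime p.
Hypothesis p_gt3 : (3 < p)%N.
Local Notation F := 'F_p.
Local Notation chi := (@quadchar F).

Lemma odd_prime_gt3 : odd p.
Proof. by case/even_prime: p_pr p_gt3 => [-> //|]. Qed.

Lemma gauss_lemma_interval (a : F) (lo hi : nat) : a != 0 -> (hi <= p)%N ->
  (forall x : F, (lo <= x < hi)%N = lower_half x && ~~ lower_half (a * x)) ->
  chi a = (-1) ^+ (hi - lo).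
Proof.
move=> a0 hip h; rewrite -(gauss_lemma p_pr odd_prime_gt3 a0).
rewrite -(minn_idPl hip) -prod_interval_sign big_mkord.
rewrite (reindex (cast_ord (Fp_cast p_pr))) /=; last first.
  by apply: onW_bij; exists (cast_ord (esym (Fp_cast p_pr)));
     [apply: cast_ordK|apply: cast_ordKV].
rewrite big_mkcond; apply: eq_bigr => x _ /=; rewrite h /half_sign.
by case: (lower_half x) => //=; case: (lower_half (a * x)).
Qed.

Lemma two_neq0 : 2 != 0 :> F.
Proof. exact: two_neq0_Fp p_pr odd_prime_gt3. Qed.

Lemma three_neq0 : 3 != 0 :> F.
Proof.
rewrite natr_Fp_eq0 // dvdn_prime2 //; apply: contraTneq p_gt3 => ->.
by [].
Qed.

Lemma quadchar_N1 : chi (-1) = (-1) ^+ p./2.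
Proof.
rewrite (@gauss_lemma_interval _ 1 p./2.+1) ?subSS ?subn0 ?oppr_eq0 ?oner_eq0 //.
  by move: p_gt3; lia.
move=> x; rewrite mulN1r; have [->|x0] := eqVneq x 0.
  by rewrite oppr0 andbN.
rewrite halfN ?odd_prime_gt3 // negbK andbb /lower_half.
by move: odd_prime_gt3; lia.
Qed.

(** In the half system, [2 * x] is in the upper half for [x > p / 4]. *)
Lemma quadchar_2 : chi 2 = (-1) ^+ (p./2 - p %/ 4).
Proof.
rewrite (@gauss_lemma_interval _ (p %/ 4).+1 p./2.+1) ?subSS ?two_neq0 //.
  by move: p_gt3; lia.
move=> x; rewrite (_ : 2 * x = x + x); last by ring.
rewrite /lower_half val_FpD //; move: (ltn_Fp p_pr x) odd_prime_gt3.
by case: ifP; lia.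
Qed.

(** In the half system, [3 * x] is in the upper half for [p / 6 < x < p / 3], and wraps around to
    the lower half beyond. *)
Lemma quadchar_3 : chi 3 = (-1) ^+ (p %/ 3 - p %/ 6).
Proof.
rewrite (@gauss_lemma_interval _ (p %/ 6).+1 (p %/ 3).+1) ?subSS ?three_neq0 //.
  by move: p_gt3; lia.
have p3 : (p %% 3 != 0)%N.
  have := three_neq0; rewrite natr_Fp_eq0 // dvdn_prime2 //.
  by apply: contra; rewrite -/(dvdn 3 p) dvdn_prime2 // eq_sym.
move=> x; rewrite (_ : 3 * x = x + x + x); last by ring.
rewrite /lower_half !val_FpD //; move: (ltn_Fp p_pr x) odd_prime_gt3.
by case: ifP; case: ifP; lia.
Qed.

(** * The cubic sum at 4 modulo 16 *)

Definition cubic_sum4 : int := cubic_sum (4 : F).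

(** For [a = 3], [g = 1] the correction terms vanish since [a + g] is a square. This leaves
    [4 K = p + 1 + chi (-1) F(4)], with [K] known modulo 4. *)
Lemma cubic_sum4_mod16 :
  modz cubic_sum4 16 =
  modz (chi (-1) * (8 * ((chi 3 == -1) && (chi (-2) == -1))%:Z - p%:Z - 1)) 16.
Proof.
have t2 := two_neq0; have t3 := three_neq0.
have t4 : 3 + 1 != 0 :> F by rewrite (_ : 3 + 1 = 2 * 2) ?mulf_neq0 //; ring.
have := card_nonresidue_set t2 t3 (oner_neq0 F) t4.
have -> : - (3 / 1) = 1 - 4 :> F by field.
rewrite cubic_sumC // -/cubic_sum4 divr1 quadchar1 card_Fp //.
have -> : 3 + 1 = 2 ^+ 2 :> F by ring.
rewrite quadchar_sqr //; have [k ->] := card_nonresidue_set_mod4 t2 t3.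
have N0 : -1 != 0 :> F by rewrite oppr_eq0 oner_eq0.
move: (_ && _) cubic_sum4 (chi (1 - 4)) => b T c.
by case: (quadcharP N0) => ->; rewrite subrr mulr0; case: b; lia.
Qed.

End PrimeField.

(** * Periodicity in the prime *)

Section RelatedParameters.

Variable p : nat.
Hypothesis p_pr : prime p.
Hypothesis p_gt3 : (3 < p)%N.
Local Notation F := 'F_p.
Local Notation chi := (@quadchar F).
Let p_odd := odd_prime_gt3 p_pr p_gt3.
Let two0 := two_neq0 p_pr p_gt3.

(** [e] matters only up to squares; it is kept explicit so that its symbol can be seen to be
    periodic in [p]. *)
Definition twist_of4 (n e : F) := cubic_sum n = chi e * cubic_sum4 p.

Lemma twist_of4C n e : twist_of4 n e -> twist_of4 (1 - n) (- e).
Proof.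
by rewrite /twist_of4 cubic_sumC // => ->; rewrite mulrA -quadcharM // mulN1r.
Qed.

Lemma twist_of4V n e : n != 0 -> twist_of4 n e -> twist_of4 n^-1 (n * e).
Proof. by rewrite /twist_of4 => n0; rewrite cubic_sumV // quadcharM // -mulrA => ->. Qed.

Lemma twist_of4_4 : twist_of4 4 1.
Proof. by rewrite /twist_of4 quadchar1 mul1r. Qed.

Lemma twist_of4_9 : twist_of4 9 (-1).
Proof. by rewrite /twist_of4 cubic_sum9. Qed.

Lemma legendreM (a b : int) : legendre p (a * b) = legendre p a * legendre p b.
Proof. by rewrite !legendreE // intrM quadcharM. Qed.

Definition diagonal_product (a g : int) : int :=
  \prod_(t in half_pairs p)
     (if a%:~R * t.1 ^+ 2 + g%:~R * t.2 ^+ 2 == 0 :> F then 1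
      else chi (a%:~R * t.1 ^+ 2 + g%:~R * t.2 ^+ 2)).

Lemma form_product_diagonal (a g : int) :
  form_product (a, 0, g) p = diagonal_product a g.
Proof.
rewrite form_productE //; apply: eq_bigr => t _ /=.
by rewrite mul0r addr0.
Qed.

(** Four times the form is [(2a - b) (j - i)^2 + (2a + b) (i + j)^2], and [(|j - i|, |i + j|)] runs
    over the same pairs. *)
Lemma form_product_symmetric (a b : int) :
  form_product (a, b, a) p = diagonal_product (2 * a - b) (2 * a + b).
Proof.
rewrite form_productE // /diagonal_product.
pose q (x y : F) := (2 * a - b)%:~R * x ^+ 2 + (2 * a + b)%:~R * y ^+ 2.
pose G x y := if q x y == 0 then 1 else chi (q x y).
rewrite -[RHS](prod_symmetric_form p_pr p_odd G); apply: eq_bigr => t _ /=.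
rewrite /G /q !half_abs_sqr.
set s := a%:~R * _ + _ + _.
have -> : (2 * a - b)%:~R * (t.2 - t.1) ^+ 2 + (2 * a + b)%:~R * (t.1 + t.2) ^+ 2 =
   2 ^+ 2 * s by rewrite /s intrB intrD intrM; ring.
by rewrite mulf_eq0 sqrf_eq0 (negPf two0) quadchar_sqrM.
Qed.

(** The right-hand side involves [p] only through itself, symbols of fixed integers and
    [cubic_sum4], once [e] is a fixed integer. *)
Lemma card_nonresidue_set_twist (a g : int) (e : F) :
  a%:~R != 0 :> F -> g%:~R != 0 :> F -> (a + g)%:~R != 0 :> F ->
  twist_of4 (- (a%:~R / g%:~R)) e ->
  4 * #|nonresidue_set (a%:~R : F) g%:~R|%:Z =
  p%:Z + legendre p g + legendre p (-1) - legendre p (-1) * legendre p g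
  + legendre p g * (chi e * cubic_sum4 p)
  - (1 + legendre p (-1) * (legendre p a * legendre p g)) *
    (1 - legendre p (a + g) * legendre p g) - 2 * (1 - legendre p (a + g)).
Proof.
move=> a0 g0 ag tw; rewrite card_nonresidue_set -?intrD // card_Fp // tw.
have chiM := quadcharM two0.
have -> : chi (- (a%:~R / g%:~R)) = chi (-1) * (chi a%:~R * chi g%:~R).
  by rewrite -(quadcharV two0 g%:~R) -!chiM mulN1r.
have -> : chi (- g%:~R) = chi (-1) * chi g%:~R by rewrite -chiM mulN1r.
have -> : chi ((a + g)%:~R / g%:~R) = chi (a + g)%:~R * chi g%:~R.
  by rewrite -(quadcharV two0 g%:~R) -chiM.
by rewrite !legendreE.
Qed.

End RelatedParameters.

(** The symbols of -1, 2 and 3 depend on [p] modulo 24, and [cubic_sum4_mod16] contains [p] modulo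
    16; 48 is the least common multiple. *)
Definition periodic48 (g : nat -> int) : Prop :=
  forall p1 p2 : nat, primes_gt3 p1 -> primes_gt3 p2 -> p1 = p2 %[mod 48] ->
  g p1 = g p2.

Lemma legendre_periodic (i j k : nat) :
  periodic48 (legendre^~ ((-1) ^+ i * 2 ^+ j * 3 ^+ k)).
Proof.
move=> p q /andP[p_pr p3] /andP[q_pr q3] pq.
have mulX (r : nat) (r_pr : prime r) (r3 : (3 < r)%N) (a : int) (n : nat) :
    legendre r (a ^+ n) = legendre r a ^+ n.
  elim: n => [|n IHn]; first by rewrite legendreE ?quadchar1.
  by rewrite !exprS legendreM // IHn.
rewrite !legendreM // !mulX // !legendreE // !mulrNz.
congr (_ ^+ _ * _ ^+ _ * _ ^+ _).
- by rewrite !quadchar_N1 // -signr_odd -[RHS]signr_odd; congr (_ ^+ _); lia.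
- by rewrite !quadchar_2 // -signr_odd -[RHS]signr_odd; congr (_ ^+ _); lia.
- by rewrite !quadchar_3 // -signr_odd -[RHS]signr_odd; congr (_ ^+ _); lia.
Qed.

Lemma cubic_sum4_periodic : periodic48 (fun p => modz (cubic_sum4 p) 16).
Proof.
move=> p q Dp Dq pq; case/andP: (Dp) => p_pr p3; case/andP: (Dq) => q_pr q3.
rewrite !cubic_sum4_mod16 //.
have LE (r : nat) (r_pr : prime r) :
  [/\ quadchar (-1 : 'F_r) = legendre r (-1), quadchar (3 : 'F_r) = legendre r 3
    & quadchar (-2 : 'F_r) = legendre r (-2)] by rewrite !legendreE.
have [-> -> ->] := LE p p_pr; have [-> -> ->] := LE q q_pr.
rewrite (legendre_periodic 1 0 0 Dp Dq pq) (legendre_periodic 0 0 1 Dp Dq pq).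
rewrite (legendre_periodic 1 1 0 Dp Dq pq) /=.
have : legendre q (-1) = 1 \/ legendre q (-1) = -1.
  by rewrite legendreE //; apply: quadcharP; rewrite oppr_eq0 oner_eq0.
by move: (_ && _) => b; case=> ->; case: b; lia.
Qed.

Lemma twist_periodic (g : nat -> int) (e : int) :
  periodic48 (legendre^~ e) ->
  (forall p, primes_gt3 p -> g p = legendre p e * cubic_sum4 p) ->
  periodic48 (fun p => modz (g p) 16).
Proof.
move=> Le gE p q Dp Dq pq; rewrite !gE // (Le _ _ Dp Dq pq).
by rewrite -modzMmr (cubic_sum4_periodic Dp Dq pq) modzMmr.
Qed.

(** The product is the sign of [K / 2], so [K] modulo 4 is enough, and this follows from [4 K]
    modulo 16. *)
Lemma diagonal_product_periodic (a g e : int) :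
  [/\ periodic48 (legendre^~ a), periodic48 (legendre^~ g),
      periodic48 (legendre^~ (a + g)) & periodic48 (legendre^~ e)] ->
  (forall p, primes_gt3 p ->
     [/\ a%:~R != 0 :> 'F_p, g%:~R != 0 :> 'F_p, (a + g)%:~R != 0 :> 'F_p
       & twist_of4 (- (a%:~R / g%:~R) : 'F_p) e%:~R]) ->
  periodic48 (fun p => diagonal_product p a g).
Proof.
move=> [La Lg Lag Le] hyp p q Dp Dq pq.
case/andP: (Dp) => p_pr p3; case/andP: (Dq) => q_pr q3.
rewrite /diagonal_product !prod_diagonal_form ?odd_prime_gt3 //.
have [a0 g0 ag0 /(card_nonresidue_set_twist p_pr p3 a0 g0 ag0)] := hyp p Dp.
have [a0' g0' ag0' /(card_nonresidue_set_twist q_pr q3 a0' g0' ag0')] := hyp q Dq.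
rewrite -!legendreE // (La _ _ Dp Dq pq) (Lg _ _ Dp Dq pq) (Lag _ _ Dp Dq pq).
have LN : periodic48 (legendre^~ (-1)) := legendre_periodic 1 0 0.
rewrite (Le _ _ Dp Dq pq) (LN _ _ Dp Dq pq) !mulrA.
have /eqP := cubic_sum4_periodic Dp Dq pq.
rewrite eqz_mod_dvd => /dvdzP[t /eqP]; rewrite subr_eq => /eqP ->.
move: #|_| #|_| => kp kq; rewrite [_ * (_ + cubic_sum4 q)]mulrDr mulrA.
move: (_ * cubic_sum4 q) (_ * t) (_ * (1 - _)) (2 * _) => s w v z.
move: (legendre q (-1) * legendre q g) (legendre q g) (legendre q (-1)) => ? ? ? Hq Hp.
(* All symbols agree at [p] and [q]; the two values of [cubic_sum4] differ by [16 * t], and [w] is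
   [t] up to a symbol. *)
have {Hp Hq} kpq : 4 * kp%:Z - 4 * kq%:Z = p%:Z - q%:Z + 16 * w by rewrite Hp Hq; ring.
have {kpq} : (kp = kq %[mod 4])%N by clear -pq kpq; lia.
clear=> kpq; rewrite -signr_odd -[RHS]signr_odd; congr (_ ^+ _); lia.
Qed.

Lemma smooth_neq0 (p i j k : nat) : primes_gt3 p ->
  ((-1) ^+ i * 2 ^+ j * 3 ^+ k : int)%:~R != 0 :> 'F_p.
Proof.
case/andP=> p_pr p3.
have X (c : int) (n : nat) : c%:~R != 0 :> 'F_p -> (c ^+ n)%:~R != 0 :> 'F_p.
  by move=> c0; rewrite rmorphXn expf_neq0.
rewrite !intrM !mulf_neq0 ?X ?oppr_eq0 ?oner_eq0 //.
- exact: two_neq0 p_pr p3.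
- exact: three_neq0 p_pr p3.
Qed.

(** * The parameters and forms of the theorem *)

Lemma twist_of4_params (p : nat) : primes_gt3 p ->
  [/\ twist_of4 (-3 : 'F_p) (-1), twist_of4 (- (1 / 3) : 'F_p) 3,
      twist_of4 (4 / 3 : 'F_p) (-3), twist_of4 (3 / 4 : 'F_p) (-4)
    & twist_of4 (1 / 4 : 'F_p) 4] /\
  [/\ twist_of4 (-8 : 'F_p) 1 & twist_of4 (1 / 9 : 'F_p) (-9)].
Proof.
move=> Dp; case/andP: (Dp) => p_pr p3.
have t2 := two_neq0 p_pr p3; have t3 := three_neq0 p_pr p3.
have t4 : 4 != 0 :> 'F_p by rewrite (_ : 4 = 2 * 2) ?mulf_neq0 //; ring.
have t9 : 9 != 0 :> 'F_p by rewrite (_ : 9 = 3 * 3) ?mulf_neq0 //; ring.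
(* The chain is 4, -3, -1/3, 4/3, 3/4, 1/4, alternating [n -> 1 - n] and [n -> 1 / n]; -8 and 1/9
   come from 9. *)
have n3 : twist_of4 (-3 : 'F_p) (-1).
  by rewrite (_ : -3 = 1 - 4); [apply/twist_of4C/twist_of4_4|ring].
have n13 : twist_of4 (- (1 / 3) : 'F_p) 3.
  have t3' : -3 != 0 :> 'F_p by rewrite oppr_eq0.
  have := twist_of4V p_pr p3 t3' n3.
  by rewrite invrN mulrN1 opprK div1r.
have n43 : twist_of4 (4 / 3 : 'F_p) (-3).
  by rewrite (_ : 4 / 3 = 1 - - (1 / 3)); [apply: twist_of4C|field].
have n34 : twist_of4 (3 / 4 : 'F_p) (-4).
  rewrite (_ : 3 / 4 = (4 / 3)^-1); last by field; rewrite t3.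
  rewrite (_ : -4 = 4 / 3 * -3); last by field.
  by apply: twist_of4V; rewrite ?mulf_neq0 ?invr_eq0.
have n14 : twist_of4 (1 / 4 : 'F_p) 4.
  rewrite (_ : 1 / 4 = 1 - 3 / 4); last by field.
  by rewrite -[X in twist_of4 _ X]opprK; apply: twist_of4C.
do 2!split=> //.
  rewrite (_ : -8 = 1 - 9); last by ring.
  by rewrite -[X in twist_of4 _ X]opprK; apply/twist_of4C/twist_of4_9.
rewrite div1r (_ : -9 = 9 * -1); last by ring.
by apply/twist_of4V/twist_of4_9.
Qed.

Lemma F01mod16_periodic (n : rat) : n \in params -> periodic48 (F01mod16 n).
Proof.
(* [s * a / d] is the reduced fraction of the parameter; [i], [j], [k] encode its twist. *)
have F01_twist (i j k a d : nat) (s : int) (m : rat) :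
    [/\ numq m = s * a & denq m = d] ->
    (forall p, primes_gt3 p -> (d%:Z)%:~R != 0 :> 'F_p /\
     twist_of4 ((s * a)%:~R / (d%:Z)%:~R : 'F_p)
       ((-1) ^+ i * 2 ^+ j * 3 ^+ k : int)%:~R) -> periodic48 (F01mod16 m).
  move=> [ma md] tw; apply: (twist_periodic (legendre_periodic i j k)) => p Dp.
  have [d0 t] := tw p Dp; case/andP: (Dp) => p_pr _.
  by rewrite F01_Fp ?md // ma t legendreE.
have D1 p : (1%:Z)%:~R != 0 :> 'F_p by apply: oner_neq0.
have D3 p : primes_gt3 p -> (3%:Z)%:~R != 0 :> 'F_p by apply: (@smooth_neq0 p 0 0 1).
have D4 p : primes_gt3 p -> (4%:Z)%:~R != 0 :> 'F_p by apply: (@smooth_neq0 p 0 2 0).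
rewrite /params !inE => /or4P[/eqP->|/eqP->|/eqP->|].
- apply: (F01_twist 0 0 0 4 1 1)%N => [|p Dp]; first by split.
  by split; [exact: D1|rewrite divr1; apply: twist_of4_4].
- apply: (F01_twist 1 0 0 3 1 (-1)%R)%N => [|p Dp]; first by split.
  by split; [exact: D1|rewrite divr1; have [[]] := twist_of4_params Dp].
- apply: (F01_twist 1 0 0 9 1 1)%N => [|p Dp]; first by split.
  case/andP: (Dp) => p_pr p3.
  by split; [exact: D1|rewrite divr1; apply: twist_of4_9].
case/or4P=> [/eqP->|/eqP->|/eqP->|/orP[]/eqP->].
- apply: (F01_twist 0 0 0 8 1 (-1)%R)%N => [|p Dp]; first by split.
  by split; [exact: D1|rewrite divr1; have [_ []] := twist_of4_params Dp].
- apply: (F01_twist 0 2 0 1 4 1)%N => [|p Dp]; first by split.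
  by split; [exact: D4|have [[]] := twist_of4_params Dp].
- apply: (F01_twist 1 2 0 3 4 1)%N => [|p Dp]; first by split.
  by split; [exact: D4|have [[]] := twist_of4_params Dp].
- apply: (F01_twist 1 0 1 4 3 1)%N => [|p Dp]; first by split.
  by split; [exact: D3|have [[]] := twist_of4_params Dp].
- apply: (F01_twist 0 0 1 1 3 (-1)%R)%N => [|p Dp]; first by split.
  split; first exact: D3.
  have [[_]] := twist_of4_params Dp.
  by rewrite -mulNr.
Qed.

Lemma form_product_periodic (f : int * int * int) :
  f \in forms -> periodic48 (form_product f).
Proof.
have L := legendre_periodic; have N := smooth_neq0.
have diag (a g e : int) : [/\ periodic48 (legendre^~ a), periodic48 (legendre^~ g),
      periodic48 (legendre^~ (a + g)) & periodic48 (legendre^~ e)] ->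
  (forall p, primes_gt3 p ->
     [/\ a%:~R != 0 :> 'F_p, g%:~R != 0 :> 'F_p, (a + g)%:~R != 0 :> 'F_p
       & twist_of4 (- (a%:~R / g%:~R) : 'F_p) e%:~R]) ->
    periodic48 (form_product (a, 0, g)).
  move=> Ls tw p q Dp Dq pq; case/andP: (Dp) (Dq) => p_pr p3 /andP[q_pr q3].
  by rewrite !form_product_diagonal //; apply: (diagonal_product_periodic Ls tw).
have sym (a b c g : int) : 2 * a - b = c -> 2 * a + b = g ->
  periodic48 (form_product (c, 0, g)) -> periodic48 (form_product (a, b, a)).
  move=> cE gE per p q Dp Dq pq; case/andP: (Dp) (Dq) => p_pr p3 /andP[q_pr q3].
  rewrite !form_product_symmetric // cE gE -!form_product_diagonal //.
  exact: per.
have d4 : periodic48 (form_product (4, 0, -1)).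
  apply: (diag 4 (-1) 1).
    by split; [exact: (L 0 2 0)%N|exact: (L 1 0 0)%N|exact: (L 0 0 1)%N|exact: (L 0 0 0)%N].
  move=> p Dp; case/andP: (Dp) => p_pr p3.
  split; [exact: (N _ 0 2 0 Dp)%N|exact: (N _ 1 0 0 Dp)%N|exact: (N _ 0 0 1 Dp)%N|].
  rewrite (_ : - _ = 4); first exact: twist_of4_4.
  by rewrite invrN1 mulrN1 opprK.
have d9 : periodic48 (form_product (9, 0, -1)).
  apply: (diag 9 (-1) (-1)).
    by split; [exact: (L 0 0 2)%N|exact: (L 1 0 0)%N|exact: (L 0 3 0)%N|exact: (L 1 0 0)%N].
  move=> p Dp; case/andP: (Dp) => p_pr p3.
  split; [exact: (N _ 0 0 2 Dp)%N|exact: (N _ 1 0 0 Dp)%N|exact: (N _ 0 3 0 Dp)%N|].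
  rewrite (_ : - _ = 9); first exact: twist_of4_9.
  by rewrite invrN1 mulrN1 opprK.
have d3 : periodic48 (form_product (3, 0, 1)).
  apply: (diag 3 1 (-1)).
    by split; [exact: (L 0 0 1)%N|exact: (L 0 0 0)%N|exact: (L 0 2 0)%N|exact: (L 1 0 0)%N].
  move=> p Dp.
  split; [exact: (N _ 0 0 1 Dp)%N|exact: (N _ 0 0 0 Dp)%N|exact: (N _ 0 2 0 Dp)%N|].
  by rewrite divr1; have [[]] := twist_of4_params Dp.
have d8 : periodic48 (form_product (8, 0, 1)).
  apply: (diag 8 1 1).
    by split; [exact: (L 0 3 0)%N|exact: (L 0 0 0)%N|exact: (L 0 0 2)%N|exact: (L 0 0 0)%N].
  move=> p Dp.
  split; [exact: (N _ 0 3 0 Dp)%N|exact: (N _ 0 0 0 Dp)%N|exact: (N _ 0 0 2 Dp)%N|].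
  by rewrite divr1; have [_ []] := twist_of4_params Dp.
(* This form and the next are not in [forms]; they arise from [(1, 1, 1)] and [(2, 5, 2)]. *)
have d13 : periodic48 (form_product (1, 0, 3)).
  apply: (diag 1 3 3).
    by split; [exact: (L 0 0 0)%N|exact: (L 0 0 1)%N|exact: (L 0 2 0)%N|exact: (L 0 0 1)%N].
  move=> p Dp.
  split; [exact: (N _ 0 0 0 Dp)%N|exact: (N _ 0 0 1 Dp)%N|exact: (N _ 0 2 0 Dp)%N|].
  by have [[]] := twist_of4_params Dp.
have d19 : periodic48 (form_product (-1, 0, 9)).
  apply: (diag (-1) 9 (-9)).
    by split; [exact: (L 1 0 0)%N|exact: (L 0 0 2)%N|exact: (L 0 3 0)%N|exact: (L 1 0 2)%N].
  move=> p Dp.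
  split; [exact: (N _ 1 0 0 Dp)%N|exact: (N _ 0 0 2 Dp)%N|exact: (N _ 0 3 0 Dp)%N|].
  by rewrite -mulNr opprK; have [_ []] := twist_of4_params Dp.
rewrite /forms !inE => /or4P[/eqP->|/eqP->|/eqP->|].
- exact: (sym 1 1 1 3).
- exact: (sym 1 (-1) 3 1).
- exact: (sym 2 5 (-1) 9).
by case/or4P=> [/eqP->|/eqP->|/eqP->|/orP[]/eqP->] //; apply: (sym 2 (-5) 9 (-1)).
Qed.

(** * From periodicity to equivalence *)

Lemma periodic48_on g : periodic48 g -> periodic_on primes_gt3 g.
Proof. by move=> per; exists 48%N; split=> // p q Dp Dq; apply: per. Qed.

Lemma periodic_on_equivalent (D : pred nat) (g h : nat -> int) :
  periodic_on D g -> periodic_on D h -> equivalent_on D g h.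
Proof.
(* The factor 2 ensures a modulus greater than 1. *)
move=> [m [m0 perg]] [n [n0 perh]]; exists (2 * (m * n))%N; split.
  by have := muln_gt0 m n; rewrite m0 n0; lia.
move=> r _ _.
(* Whether the residue class meets [D] is decided classically. If it does, both functions are
   constant on it; if not, any linear polynomial serves. *)
have [[q [Dq qr]]|none] := Classical_Prop.classic
  (exists q, D q /\ q = r %[mod 2 * (m * n)]); last first.
  by exists 'X => [|p Dp pr]; [exact: size_polyX|case: none; exists p].
exists ('X + (g q - h q)%:~R%:P) => [|p Dp pr]; first exact: size_XaddC.
have modd d : (d %| 2 * (m * n))%N -> p = q %[mod d].
  by move=> dv; rewrite -(modn_dvdm p dv) -(modn_dvdm q dv) pr qr.
rewrite !hornerE (perg p q) ?(perh p q) //; first by rewrite intrB addrC subrK.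
  by apply: modd; rewrite dvdn_mull // dvdn_mull.
by apply: modd; rewrite dvdn_mull // dvdn_mulr.
Qed.

Theorem theorem3p4 :
  [/\ (forall n1 n2 : rat, n1 \in params -> n2 \in params ->
         equivalent_on primes_gt3 (F01mod16 n1) (F01mod16 n2)),
      (forall f : int * int * int, f \in forms ->
         equivalent_on primes_gt3 (F01mod16 4) (form_product f))
    & periodic_on primes_gt3 (F01mod16 4) /\
      (forall f : int * int * int, f \in forms ->
         periodic_on primes_gt3 (form_product f))].
Proof.
have pF n : n \in params -> periodic_on primes_gt3 (F01mod16 n).
  by move=> nP; apply/periodic48_on/F01mod16_periodic.
have pP f : f \in forms -> periodic_on primes_gt3 (form_product f).
  by move=> fP; apply/periodic48_on/form_product_periodic.
split=> [n1 n2 n1P n2P|f fP|].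
- by apply: periodic_on_equivalent; apply: pF.
- by apply: periodic_on_equivalent; [apply: pF|apply: pP].
- by split=> //; apply: pF.
Qed.
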